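(* Let $F$ be a finitely generated free group, let $\varphi \in \operatorname{Aut}(F)$, and let $G = F \rtimes_{\varphi} \mathbb{Z}$. Then $G$ is equationally Noetherian. In other words, all free-by-cyclic groups are equationally Noetherian.
   Context: A group is free-by-cyclic if it admits the structure of a semidirect product $F \rtimes_{\varphi} \mathbb{Z}$ with $F$ a finitely generated free group, where the generator of $\mathbb{Z}$ acts on $F$ by $\varphi$. Let $\mathbb{F}_m$ be a free group with basis $x_1,\ldots,x_m$. For $s \in \mathbb{F}_m$, a group $G$ and $(g_1,\ldots,g_m) \in G^m$, write $s(g_1,\ldots,g_m)$ for the image of $s$ under the homomorphism $\mathbb{F}_m \to G$ sending $x_i \mapsto g_i$. For $S \subseteq \mathbb{F}_m$ let $V_G(S) = \{ (g_1,\ldots,g_m) \in G^m \mid s(g_1,\ldots,g_m) = 1 \text{ for all } s \in S \}$. The group $G$ is equationally Noetherian if for every positive integer $m$ and every $S \subseteq \mathbb{F}_m$ there exists a finite subset $S_0 \subseteq S$ such that $V_G(S_0) = V_G(S)$. *)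

(* Defs.v *)
From HB Require Import structures.
From mathcomp Require Import all_boot all_order all_algebra.
From mathcomp Require Import all_classical.
From mathcomp Require Import zify ring.
Set Implicit Arguments.
Unset Strict Implicit.
Unset Printing Implicit Defensive.
Import GRing.Theory.
Local Open Scope classical_set_scope.
Local Open Scope group_scope.

Section FreeGroup.
Variable I : choiceType.

(* (i, true) stands for the basis element i, (i, false) for its inverse. *)
Local Notation letter := (I * bool)%type.

Definition invl (a : letter) : letter := (a.1, ~~ a.2).

Definition reduced (w : seq letter) : bool :=
  sorted (fun a b => b != invl a) w.

(* The reduced form of a :: w, for w reduced. *)
Definition push (a : letter) (w : seq letter) : seq letter :=
  if w is b :: w' then if b == invl a then w' else a :: w else [:: a].

Lemma invlK : involutive invl.
Proof. by case=> i b; rewrite /invl /= negbK. Qed.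

Lemma reduced_push a w : reduced w -> reduced (push a w).
Proof.
case: w => [|b w] //= bw; case: ifPn => [_|nab]; first exact: path_sorted bw.
by rewrite /reduced /= nab.
Qed.

Lemma reduced_foldr s w : reduced w -> reduced (foldr push w s).
Proof. by move=> rw; elim: s => //= a s; apply: reduced_push. Qed.

Lemma pushK a w : reduced w -> push (invl a) (push a w) = w.
Proof.
case: w => [|b w] /= bw; first by rewrite invlK eqxx.
case: ifPn => [/eqP bE|_]; last by rewrite /= invlK eqxx.
case: w bw => [|c w]; rewrite /reduced /= bE // => /andP[/negbTE nca _].
by rewrite nca.
Qed.

Lemma pushVK a w : reduced w -> push a (push (invl a) w) = w.
Proof. by move=> rw; rewrite -{1}[a]invlK pushK. Qed.

Lemma foldr_push a s w : reduced w ->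
  foldr push w (push a s) = push a (foldr push w s).
Proof.
move=> rw; case: s => [|b s] //=; case: ifPn => [/eqP ->|] //.
by rewrite pushVK //; exact: reduced_foldr.
Qed.

Lemma foldr_push_nil w : reduced w -> foldr push [::] w = w.
Proof.
elim: w => //= a w IH aw; rewrite IH; last exact: path_sorted aw.
case: w aw {IH} => [|b w] //=.
by rewrite /reduced /= => /andP[/negbTE -> _].
Qed.

Lemma foldr_push_cat s t w : reduced w ->
  foldr push w (foldr push t s) = foldr push (foldr push w t) s.
Proof. by move=> rw; elim: s => //= a s IH; rewrite foldr_push // IH. Qed.

Definition invw (w : seq letter) : seq letter := rev (map invl w).

Lemma invwK : involutive invw.
Proof. by move=> w; rewrite /invw map_rev revK mapK //; exact: invlK. Qed.

Lemma reduced_invw w : reduced w -> reduced (invw w).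
Proof.
rewrite /reduced /invw rev_sorted sorted_map; apply: sub_sorted => a b /=.
by rewrite invlK eq_sym.
Qed.

Lemma invwVK s w : reduced w -> foldr push (foldr push w s) (invw s) = w.
Proof.
move=> rw; elim: s => //= a s IH; rewrite /invw /= rev_cons -cats1 foldr_cat /=.
by rewrite pushK //; exact: reduced_foldr.
Qed.

Record freeGroup : Type :=
  FreeGroup { fg_word :> seq letter; fg_reduced : reduced fg_word }.
HB.instance Definition _ := [isSub for fg_word].
HB.instance Definition _ := [Choice of freeGroup by <:].

Implicit Types u v w : freeGroup.

Definition fg1 : freeGroup := @FreeGroup [::] isT.
Definition fgM u v : freeGroup :=
  FreeGroup (reduced_foldr (val u) (valP v)).
Definition fgV u : freeGroup := FreeGroup (reduced_invw (valP u)).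

Lemma fgA : associative fgM.
Proof. by move=> u v w; apply: val_inj; rewrite /= foldr_push_cat ?(valP w). Qed.

Lemma fg1M : left_id fg1 fgM.
Proof. by move=> u; apply: val_inj. Qed.

Lemma fgM1 : right_id fg1 fgM.
Proof. by move=> u; apply: val_inj; rewrite /= foldr_push_nil ?(valP u). Qed.

Lemma fgVM : left_inverse fg1 fgV fgM.
Proof.
move=> u; apply: val_inj; rewrite /= -{1}(foldr_push_nil (valP u)).
by rewrite invwVK.
Qed.

Lemma fgMV : right_inverse fg1 fgV fgM.
Proof.
move=> u; have := fgVM (fgV u); congr (fgM _ _ = _).
by apply: val_inj; rewrite /= invwK.
Qed.

HB.instance Definition _ := isGroup.Build freeGroup fgA fg1M fgM1 fgVM fgMV.

Definition fgen (i : I) : freeGroup := @FreeGroup [:: (i, true)] isT.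

Section Lift.
Variables (H : groupType) (f : I -> H).

Definition eval_letter (a : letter) : H := if a.2 then f a.1 else (f a.1)^-1.

(* The homomorphism freeGroup I -> H that sends each fgen i to f i; see
   fg_lift_gen and fg_lift_uniq. *)
Definition fg_lift (w : freeGroup) : H := \prod_(a <- val w) eval_letter a.

Lemma eval_invl a : eval_letter (invl a) = (eval_letter a)^-1.
Proof. by case: a => i [] //=; rewrite /eval_letter /= invgK. Qed.

Lemma prod_push a s :
  \prod_(b <- push a s) eval_letter b
    = eval_letter a * \prod_(b <- s) eval_letter b.
Proof.
case: s => [|b s] /=; first by rewrite big_seq1 big_nil mulg1.
case: ifPn => [/eqP ->|_]; last by rewrite big_cons.
by rewrite big_cons eval_invl mulgA mulgV mul1g.
Qed.

Lemma fg_liftM : {morph fg_lift : u v / u * v}.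
Proof.
move=> u v; rewrite /fg_lift /=; elim: (val u) => [|a s IH] /=.
  by rewrite big_nil mul1g.
by rewrite prod_push IH big_cons mulgA.
Qed.

HB.instance Definition _ := isMultiplicative.Build freeGroup H fg_lift fg_liftM.

Lemma fg_lift_gen i : fg_lift (fgen i) = f i.
Proof. by rewrite /fg_lift big_seq1. Qed.

End Lift.

Lemma fg_lift_uniq (H : groupType) (h : {multiplicative freeGroup -> H}) w :
  h w = fg_lift (h \o fgen) w.
Proof.
have h1 : h 1 = 1 by apply: (mulgI (h 1)); rewrite -gmulfM !mulg1.
have hV x : h x^-1 = (h x)^-1.
  by apply: (mulgI (h x)); rewrite -gmulfM !mulgV.
case: w => s rs; rewrite /fg_lift /=.
elim: s rs => [|a s IH] rs.
  by rewrite big_nil -h1; congr (h _); apply: val_inj.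
have rs' : reduced s by exact: path_sorted rs.
have ra : reduced [:: a] by [].
have -> : FreeGroup rs = FreeGroup ra * FreeGroup rs'.
  apply: val_inj => /=; case: s rs {IH rs'} => [|b s] //=.
  by rewrite /reduced /= => /andP[/negbTE -> _].
rewrite gmulfM IH big_cons; congr (_ * _).
case: a {rs} ra => i [] ra; rewrite /eval_letter /=.
  by congr (h _); apply: val_inj.
by rewrite -hV; congr (h _); apply: val_inj.
Qed.

End FreeGroup.

Definition free_basis (F : groupType) (I : choiceType) (x : I -> F) : Prop :=
  bijective (fg_lift x).

Definition is_free (F : groupType) : Prop :=
  exists (I : choiceType) (x : I -> F), free_basis x.

Definition is_subgroup (G : groupType) (H : set G) : Prop :=
  H 1 /\ (forall x y, H x -> H y -> H (x / y)).

Definition generated (G : groupType) (A : set G) : set G :=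
  smallest (@is_subgroup G) A.

Definition finitely_generated (G : groupType) : Prop :=
  exists2 A : set G, finite_set A & generated A = setT.

Record automorphism (G : groupType) := Automorphism {
  aut_fun :> {multiplicative G -> G};
  aut_inv : G -> G;
  aut_funK : cancel aut_fun aut_inv;
  aut_invK : cancel aut_inv aut_fun }.

Lemma automorphism_of_bij (G : groupType) (f : {multiplicative G -> G}) :
  bijective f -> exists phi : automorphism G, aut_fun phi = f.
Proof. by case=> g fK gK; exists (Automorphism fK gK). Qed.

Section AutPower.
Variables (F : groupType) (phi : automorphism F).

(* The k-th power of phi in Aut(F). *)
Definition aut_expz (k : int) : F -> F :=
  match k with
  | Posz n => iter n phi
  | Negz n => iter n.+1 (aut_inv phi)
  end.

Lemma aut_expzS k x : aut_expz (1 + k)%R x = phi (aut_expz k x).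
Proof.
case: k => [n|[|n]]; [by [] | by rewrite /= aut_invK |].
have -> : (1 + Negz n.+1)%R = Negz n by rewrite !NegzE; lia.
by rewrite /= aut_invK.
Qed.

Lemma aut_expzP k x : aut_expz (k - 1)%R x = aut_inv phi (aut_expz k x).
Proof. by rewrite -{2}(subrKC 1%R k) aut_expzS aut_funK. Qed.

Lemma aut_expzD k l x : aut_expz (k + l)%R x = aut_expz k (aut_expz l x).
Proof.
elim: k => [|n IH|n IH]; first by rewrite add0r.
  by rewrite intS -addrA !aut_expzS IH.
have -> : (- n.+1%:Z + l = (- n%:Z + l) - 1)%R by rewrite intS; ring.
have -> : (- n.+1%:Z = - n%:Z - 1)%R by rewrite intS; ring.
by rewrite !aut_expzP IH.
Qed.

Lemma aut_expzM k : {morph aut_expz k : x y / x * y}.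
Proof.
move=> x y; case: k => n /=.
  by elim: n => //= n ->; rewrite gmulfM.
have VM := can2_gmulfM (aut_funK phi) (aut_invK phi).
by rewrite -VM; congr (aut_inv phi _); elim: n => //= n ->; rewrite VM.
Qed.

Lemma aut_expz1 k : aut_expz k 1 = 1.
Proof. by apply: (mulgI (aut_expz k 1)); rewrite -aut_expzM !mulg1. Qed.

End AutPower.

(* SemidirectZ phi x k stands for x * t ^ k, where t * y * t^-1 = phi y. *)
Record semidirectZ (F : groupType) (phi : automorphism F) : Type :=
  SemidirectZ { sd_base : F; sd_exp : int }.

Section SemidirectZ.
Variables (F : groupType) (phi : automorphism F).

Definition sd_pair (u : semidirectZ phi) : F * int := (sd_base u, sd_exp u).
Definition pair_sd (p : F * int) : semidirectZ phi := SemidirectZ phi p.1 p.2.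

Lemma sd_pairK : cancel sd_pair pair_sd.
Proof. by case. Qed.

HB.instance Definition _ := Choice.copy (semidirectZ phi) (can_type sd_pairK).

Implicit Types u v w : semidirectZ phi.

Definition sd1 : semidirectZ phi := SemidirectZ phi 1 0%R.
Definition sdM u v : semidirectZ phi :=
  SemidirectZ phi (sd_base u * aut_expz phi (sd_exp u) (sd_base v))
    (sd_exp u + sd_exp v)%R.
Definition sdV u : semidirectZ phi :=
  SemidirectZ phi (aut_expz phi (- sd_exp u)%R (sd_base u)^-1) (- sd_exp u)%R.

Lemma sdA : associative sdM.
Proof. by move=> u v w; rewrite /sdM /= aut_expzM aut_expzD mulgA addrA. Qed.

Lemma sd1M : left_id sd1 sdM.
Proof. by case=> x k; rewrite /sdM /= mul1g add0r. Qed.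

Lemma sdM1 : right_id sd1 sdM.
Proof. by case=> x k; rewrite /sdM /= aut_expz1 mulg1 addr0. Qed.

Lemma sdVM : left_inverse sd1 sdV sdM.
Proof. by case=> x k; rewrite /sdM /= -aut_expzM mulVg aut_expz1 addNr. Qed.

Lemma sdMV : right_inverse sd1 sdV sdM.
Proof. by case=> x k; rewrite /sdM /= -aut_expzD subrr mulgV. Qed.

HB.instance Definition _ :=
  isGroup.Build (semidirectZ phi) sdA sd1M sdM1 sdVM sdMV.

Definition sd_incl (x : F) : semidirectZ phi := SemidirectZ phi x 0%R.
Definition sd_t : semidirectZ phi := SemidirectZ phi 1 1%R.

Lemma sd_conj x : sd_t * sd_incl x * sd_t^-1 = sd_incl (phi x).
Proof.
have -> : sd_t * sd_incl x = SemidirectZ phi (phi x) 1%R.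
  by congr SemidirectZ; rewrite /= mul1g.
rewrite -[LHS]/(sdM _ (sdV _)) /sdM /sdV; congr SemidirectZ.
by rewrite invg1 !aut_expz1 mulg1.
Qed.

End SemidirectZ.

Definition free_by_cyclic (G : groupType) : Prop :=
  exists (F : groupType) (phi : automorphism F),
    [/\ is_free F, finitely_generated F &
        exists h : {multiplicative semidirectZ phi -> G}, bijective h].

Definition solution_set (G : groupType) (m : nat) (S : set (freeGroup 'I_m)) :
    set ('I_m -> G) :=
  [set g | forall s, S s -> fg_lift g s = 1].
Arguments solution_set G {m} S.

Definition equationally_Noetherian (G : groupType) : Prop :=
  forall m : nat, (0 < m)%N -> forall S : set (freeGroup 'I_m),
  exists S0 : set (freeGroup 'I_m),
    [/\ finite_set S0, S0 `<=` S & solution_set G S0 = solution_set G S].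

(* Main.v *)
Require Import Defs.
From mathcomp Require Import all_boot all_order all_algebra all_classical.
From HB Require Import structures.
From mathcomp Require Import mpoly zify ring lra.

Set Implicit Arguments.
Unset Strict Implicit.
Unset Printing Implicit Defensive.
Import Order.TTheory GRing.Theory Num.Theory.
Local Open Scope classical_set_scope.
Local Open Scope ring_scope.

(** Free-by-cyclic groups are treated here as linear groups over a ring with
    an automorphism, and the Hilbert basis theorem behind the equational
    Noetherianity of linear groups is replaced by a basis theorem for
    difference polynomials in the style of Ritt and Raudenbush.

    Let F be free and let r range over the homomorphisms from F to the group
    E2 generated by transvections in SL_2(Q). Precomposition with phi permutes
    these representations. Write a tuple of elements of the semidirect product
    as g_i = x_i t^(k_i). Multiplying out a word in the g_i gives an element
    of F that is a product of terms phi^(a.k)(x_i)^(+-1), with integral vectors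
    a that depend only on the word, and a power of t that is linear in k.
    Hence, after conjugating by a power of t that makes every a non-negative,
    the word is trivial at g exactly when finitely many polynomials, which
    depend only on the word, vanish at all points z_r: the coordinates of z_r
    are the matrix entries of r(phi^(a.k)(x_i)^(+-1)), for a in N^m, and the
    k_i. The converse half of this uses that the representations separate the
    elements of F (rep_separates, a ping-pong argument with degrees).

    The polynomials vanishing at all z_r form a set Q_g with two properties.
    It is invariant under the translations a |-> a + b, in both directions,
    because translating z_r amounts to replacing r by its composite with a
    power of phi. It is prime, because any two representations are joined by a
    polynomial curve of representations (rep_curve). The exponents k have
    become part of the data on which Q_g depends, so one basis theorem covers
    all of them at once.

    That theorem (difference_basis) says: for a set S of polynomials there is
    a finite part l of S such that every invariant prime of the family that
    contains l contains S. If it fails, take an ultralimit P, containing S, of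
    primes Q_t that do not contain S. By Dickson's lemma, finitely many members
    of P with initial outside P have leaders of which every such leader is a
    translate, with at least the same degree. For almost all t these finitely
    many polynomials lie in Q_t and their initials do not; pseudo-division
    (pseudo_reduction) then puts all of P, and so S, into Q_t. *)

(** * Dickson's lemma *)

(** The coordinates of k are listed as functions fs, so that the induction is
    on their number. For one more coordinate f, a basis l for the others has
    bounded values N of f; it handles the elements with f >= N, and each of
    the finitely many slices f = M < N has a basis of its own. The label c
    takes finitely many values and has to be matched exactly. *)
Lemma dickson (K : eqType) (J : finType) (c : K -> J) (fs : seq (K -> nat))
    (W : set K) :
  exists l : seq K, (forall k, k \in l -> W k) /\
    forall w, W w ->
      exists2 k, k \in l & c k = c w /\ all (fun f => f k <= f w)%N fs.
Proof.
elim: fs W => [|f fs IH] W.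
  suff [l [lW lP]] : exists l : seq K, (forall k, k \in l -> W k) /\
      forall w, W w -> c w \in enum J -> exists2 k, k \in l & c k = c w.
    exists l; split=> // w Ww; have [|k kl ck] := lP w Ww.
      by rewrite mem_enum.
    by exists k.
  elim: (enum J) => [|j js [l [lW lP]]]; first by exists [::].
  have [[k [Wk ck]]|none] := pselect (exists k, W k /\ c k = j).
    exists (k :: l); split=> [i|w Ww].
      by rewrite inE => /orP[/eqP -> //|]; exact: lW.
    rewrite inE => /orP[/eqP cw|wl].
      by exists k; rewrite ?inE ?eqxx // ck.
    by have [i il ci] := lP w Ww wl; exists i; rewrite // inE il orbT.
  exists l; split=> // w Ww; rewrite inE => /orP[/eqP cw|]; last exact: lP.
  by case: none; exists w.
have [l [lW lP]] := IH W.
have [N leN] : exists N, forall k, k \in l -> (f k <= N)%N.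
  exists (\max_(k <- l) f k) => k kl; exact: leq_bigmax_seq.
have [l' [l'W l'P]] : exists l' : seq K, (forall k, k \in l' -> W k) /\
    forall w, W w -> (f w < N)%N -> exists2 k, k \in l' &
      c k = c w /\ all (fun g => g k <= g w)%N (f :: fs).
  elim: (N) => [|M [l' [l'W l'P]]]; first by exists [::].
  have [l2 [l2W l2P]] := IH [set k | W k /\ f k = M].
  exists (l' ++ l2); split=> [k|w Ww].
    by rewrite mem_cat => /orP[/l'W //|/l2W[]].
  rewrite ltnS leq_eqVlt => /orP[/eqP fw|/(l'P w Ww)[k kl' kP]]; last first.
    by exists k; rewrite // mem_cat kl'.
  have [k kl2 [ck kP]] := l2P w (conj Ww fw); exists k.
    by rewrite mem_cat kl2 orbT.
  by split=> //=; have [_ ->] := l2W k kl2; rewrite fw leqnn.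
exists (l ++ l'); split=> [k|w Ww].
  by rewrite mem_cat => /orP[/lW|/l'W].
have [Nw|wN] := leqP N (f w).
  have [k kl [ck kP]] := lP w Ww; exists k; first by rewrite mem_cat kl.
  by split=> //=; rewrite kP andbT (leq_trans (leN k kl)).
by have [k kl' kP] := l'P w Ww wN; exists k; rewrite // mem_cat kl' orbT.
Qed.

(** * A basis theorem for difference polynomials *)

Section DifferenceVariables.
Variables (n : nat) (J : finType).
Local Notation V := ('X_{1..n} * J)%type.

(** The variable (a, j) stands for the a-th transform of the j-th unknown. *)
Definition dshift (a : 'X_{1..n}) (v : V) : V := ((a + v.1)%MM, v.2).

(** Any well-founded total order that is strictly preserved by dshift would
    do. Here the transforms are compared by a monomial order, and ties are
    broken by an enumeration of the unknowns. *)
Definition dlt (v w : V) : bool :=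
  (v.1 < w.1)%O || ((v.1 == w.1) && (enum_rank v.2 < enum_rank w.2)%N).

Lemma dlt_wf : well_founded dlt.
Proof.
suff H : forall a k j, (enum_rank j < k)%N -> Acc dlt (a, j : J).
  by case=> a j; exact: (H a (enum_rank j).+1).
move=> a; elim/(well_founded_ind (@ltom_wf n)): a => a IHa.
elim=> [//|k IHk] j; rewrite ltnS => jk; constructor=> -[b i].
rewrite /dlt /= => /orP[ba|/andP[/eqP -> ij]].
  exact: (IHa b ba (enum_rank i).+1).
exact: IHk (leq_trans ij jk).
Qed.

Lemma dlt_shift a v w : dlt v w -> dlt (dshift a v) (dshift a w).
Proof. by rewrite /dlt /= ltmc_add2r eqm_add2l. Qed.

Lemma dlt_total v w : [|| dlt v w, v == w | dlt w v].
Proof.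
case: v w => [a i] [b j]; rewrite /dlt /= -pair_eqE /=.
case: (ltgtP a b) => //= _.
case: (ltngtP (enum_rank i) (enum_rank j)) => [|_|eij]; rewrite ?orbT //.
by rewrite (enum_rank_inj (ord_inj eij)) eqxx.
Qed.

Lemma dlt_trans v w u : dlt v w -> dlt w u -> dlt v u.
Proof.
rewrite /dlt => /orP[vw|/andP[/eqP -> vw]] /orP[wu|/andP[/eqP <- wu]].
- by rewrite (lt_trans vw wu).
- by rewrite vw.
- by rewrite wu.
- by rewrite eqxx (ltn_trans vw wu) orbT.
Qed.

End DifferenceVariables.

Section DifferenceBasis.
Variables (n : nat) (J : finType) (A : comNzRingType).
Local Notation V := ('X_{1..n} * J)%type.
Variables (tau : 'X_{1..n} -> {rmorphism A -> A}) (x : V -> A) (C : set A).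
Hypothesis tau_x : forall a v, tau a (x v) = x (dshift a v).
Hypothesis tau_C : forall a c, C c -> C (tau a c).
Hypotheses (C0 : C 0) (C1 : C 1).

(** The subring of A of polynomials in the variables from B. The ring A is
    arbitrary because reduction only needs every element to be written in some
    way as a polynomial in its leading variable; it will be a ring of
    functions, in which polynomials need no normal form. *)
Inductive dpoly (B : set V) : A -> Prop :=
  | dpoly_const c : C c -> dpoly B c
  | dpoly_var v : B v -> dpoly B (x v)
  | dpoly_add f g : dpoly B f -> dpoly B g -> dpoly B (f + g)
  | dpoly_opp f : dpoly B f -> dpoly B (- f)
  | dpoly_mul f g : dpoly B f -> dpoly B g -> dpoly B (f * g).

Definition below (v : V) : set V := [set w | dlt w v].
Definition upto (v : V) : set V := [set w | dlt w v || (w == v)].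

Lemma dpolyS B B' f : B `<=` B' -> dpoly B f -> dpoly B' f.
Proof.
move=> BB'; elim=> {f} [c Cc|v /BB' B'v|f g _ ? _ ?|f _ ?|f g _ ? _ ?].
- exact: dpoly_const.
- exact: dpoly_var.
- exact: dpoly_add.
- exact: dpoly_opp.
- exact: dpoly_mul.
Qed.

Lemma dpoly_tau a v f : dpoly (below v) f -> dpoly (below (dshift a v)) (tau a f).
Proof.
elim=> {f} [c Cc|w wv|f g _ ? _ ?|f _ ?|f g _ ? _ ?].
- exact/dpoly_const/tau_C.
- by rewrite tau_x; apply: dpoly_var; exact: dlt_shift.
- by rewrite rmorphD; exact: dpoly_add.
- by rewrite rmorphN; exact: dpoly_opp.
- by rewrite rmorphM; exact: dpoly_mul.
Qed.

Lemma dpoly_sum B (I : Type) (r : seq I) (F : I -> A) :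
  (forall i, dpoly B (F i)) -> dpoly B (\sum_(i <- r) F i).
Proof.
by move=> BF; apply: big_ind => //; [exact: dpoly_const|exact: dpoly_add].
Qed.

Lemma dpoly_horner v f : dpoly (upto v) f ->
  exists2 p : {poly A}, (forall i, dpoly (below v) p`_i) & f = p.[x v].
Proof.
have B0 := dpoly_const (below v) C0.
elim=> {f} [c Cc|w|f g _ [p Bp ->] _ [q Bq ->]|f _ [p Bp ->]
           |f g _ [p Bp ->] _ [q Bq ->]].
- exists c%:P; last by rewrite hornerC.
  by move=> i; rewrite coefC; case: eqP => // _; exact: dpoly_const.
- move=> /orP[wv|/eqP ->].
    exists (x w)%:P; last by rewrite hornerC.
    by move=> i; rewrite coefC; case: eqP => // _; exact: dpoly_var.
  exists 'X; last by rewrite hornerX.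
  by move=> i; rewrite coefX; case: eqP => // _; exact: dpoly_const.
- by exists (p + q); [move=> i; rewrite coefD; exact: dpoly_add|rewrite hornerD].
- by exists (- p); [move=> i; rewrite coefN; exact: dpoly_opp|rewrite hornerN].
- exists (p * q); last by rewrite hornerM.
  by move=> i; rewrite coefM; apply: dpoly_sum => j; exact: dpoly_mul.
Qed.

Lemma horner_dpoly v (p : {poly A}) :
  (forall i, dpoly (below v) p`_i) -> dpoly setT p.[x v].
Proof.
move=> Bp; rewrite horner_coef; apply: dpoly_sum => i; apply: dpoly_mul.
  exact: dpolyS (Bp i).
elim: (nat_of_ord i) => [|j IH]; first by rewrite expr0; exact: dpoly_const.
by rewrite exprS; apply: dpoly_mul IH; exact: dpoly_var.
Qed.

Lemma upto_trans v w : dlt v w || (v == w) -> upto v `<=` upto w.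
Proof.
move=> vw u /orP[uv|/eqP ->] //; apply/orP; left.
by case/orP: vw => [vw|/eqP <- //]; exact: dlt_trans uv vw.
Qed.

(** The leader of f: the largest variable occurring in an expression of f,
    which exists unless f is an expression in constants only. *)
Lemma dpoly_leader B f : dpoly B f ->
  dpoly set0 f \/ exists2 v, B v & dpoly (upto v) f.
Proof.
have two f1 f2 : dpoly set0 f1 \/ (exists2 v, B v & dpoly (upto v) f1) ->
    dpoly set0 f2 \/ (exists2 v, B v & dpoly (upto v) f2) ->
    (dpoly set0 f1 /\ dpoly set0 f2) \/
    (exists2 v, B v & dpoly (upto v) f1 /\ dpoly (upto v) f2).
  move=> [c1|[v Bv v1]] [c2|[w Bw w2]].
  - by left.
  - by right; exists w => //; split=> //; exact: dpolyS c1.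
  - by right; exists v => //; split=> //; exact: dpolyS c2.
  - right; have /or3P[vw|/eqP vw|wv] := dlt_total v w.
    + exists w => //; split=> //; apply: dpolyS v1; apply: upto_trans.
      by rewrite vw.
    + by exists w => //; split=> //; rewrite -vw.
    + exists v => //; split=> //; apply: dpolyS w2; apply: upto_trans.
      by rewrite wv.
elim=> {f} [c Cc|v Bv|f g _ IHf _ IHg|f _ [IH|[v Bv IH]]|f g _ IHf _ IHg].
- by left; exact: dpoly_const.
- by right; exists v => //; apply: dpoly_var; rewrite /upto /= eqxx orbT.
- have [[? ?]|[v Bv [? ?]]] := two _ _ IHf IHg; [left|right; exists v => //];
  exact: dpoly_add.
- by left; exact: dpoly_opp.
- by right; exists v => //; exact: dpoly_opp.
- have [[? ?]|[v Bv [? ?]]] := two _ _ IHf IHg; [left|right; exists v => //];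
  exact: dpoly_mul.
Qed.

(** Primality is required on polynomials only. In the application A is a ring
    of arbitrary functions, and irreducibility of a set of points says nothing
    about functions that are not polynomial. *)
Record difference_prime (Q : set A) : Prop := DifferencePrime {
  dprime0 : Q 0;
  dprimeD : forall f g, Q f -> Q g -> Q (f + g);
  dprimeM : forall f g, Q g -> Q (f * g);
  dprime_tau : forall a f, Q (tau a f) <-> Q f;
  dprime_const : forall f, dpoly set0 f -> Q f -> f = 0;
  dprimeP : forall f g, dpoly setT f -> dpoly setT g -> Q (f * g) -> Q f \/ Q g
}.

(** Induction on the leader v and on the degree in v of a member p.[x v] of P.
    If the initial of p lies in P, it lies in Q by induction, and so does what
    remains of p after removing its top term. Otherwise v is a translate, by a
    say, of the leader w of some q in lead; subtracting a multiple of
    tau a q.[x w] from tau a (lead_coef q) * p.[x v] lowers the degree, so that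
    this product lies in Q. Its first factor does not, because Q is invariant,
    and Q is prime. *)
Lemma pseudo_reduction (P Q : set A) (lead : set (V * {poly A})) :
  difference_prime Q ->
  (forall f g, P f -> P g -> P (f + g)) -> (forall f g, P g -> P (f * g)) ->
  (forall a f, P f -> P (tau a f)) ->
  (forall f, dpoly set0 f -> P f -> f = 0) ->
  (forall v (q : {poly A}), lead (v, q) -> [/\ forall i, dpoly (below v) q`_i,
     P q.[x v], Q q.[x v] & ~ Q (lead_coef q)]) ->
  (forall v (p : {poly A}), (forall i, dpoly (below v) p`_i) -> P p.[x v] ->
     ~ P (lead_coef p) -> exists w q, [/\ lead (w, q), v.2 = w.2,
       (w.1 <= v.1)%MM & (size q <= size p)%N]) ->
  forall f, dpoly setT f -> P f -> Q f.
Proof.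
move=> pQ PD PM Ptau Pconst leadP leadE.
have PN f : P f -> P (- f) by move=> Pf; rewrite -mulN1r; exact: PM.
suff main v (p : {poly A}) : (forall i, dpoly (below v) p`_i) -> P p.[x v] -> Q p.[x v].
  move=> f /dpoly_leader[cf Pf|[v _ /dpoly_horner[p Bp ->]]]; last exact: main.
  by rewrite (Pconst f cf Pf); exact: dprime0.
elim/(well_founded_ind (@dlt_wf n J)): v p => v IHv p.
have low f : dpoly (below v) f -> P f -> Q f.
  move=> /dpoly_leader[cf Pf|[w wv /dpoly_horner[q Bq ->]]]; last exact: IHv.
  by rewrite (Pconst f cf Pf); exact: dprime0.
have [d] := ubnP (size p); elim: d p => [//|d IHd] p szp Bp Pp.
have [->|p0] := eqVneq p 0; first by rewrite horner0; exact: dprime0.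
have szp0 : (0 < size p)%N by rewrite size_poly_gt0.
have [Plc|nPlc] := pselect (P (lead_coef p)).
  pose t := (lead_coef p)%:P * 'X^((size p).-1); pose p' := p - t.
  have tE : t.[x v] = x v ^+ ((size p).-1) * lead_coef p.
    by rewrite /t hornerM hornerC hornerXn mulrC.
  have Qt : Q t.[x v].
    by rewrite tE; apply: dprimeM => //; apply: low Plc; exact: Bp.
  have -> : p = p' + t by rewrite /p' subrK.
  rewrite hornerD; apply: dprimeD => //; apply: IHd.
  - rewrite -ltnS; apply: leq_trans szp; rewrite ltnS -(prednK szp0) ltnS.
    apply/leq_sizeP => j; rewrite leq_eqVlt => /orP[/eqP <-|ltj].
      by rewrite coefB coefCM coefXn eqxx mulr1 subrr.
    rewrite coefB coefCM coefXn gtn_eqF // mulr0 subr0 nth_default //.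
    by rewrite -(prednK szp0).
  - move=> i; rewrite coefB coefCM coefXn; apply: dpoly_add => //.
    apply/dpoly_opp/dpoly_mul; first exact: Bp.
    by apply: dpoly_const; case: eqP.
  - rewrite hornerD hornerN; apply: PD => //; apply: PN.
    by rewrite tE; apply: PM.
have [w [q [leadq vw2 wv1 szq]]] := leadE v p Bp Pp nPlc.
have [Bq Pq Qq nQlc] := leadP w q leadq.
have szq0 : (0 < size q)%N.
  rewrite size_poly_gt0; apply: contra_notN nQlc => /eqP ->.
  by rewrite lead_coef0; exact: dprime0.
pose a := (v.1 - w.1)%MM.
have vE : dshift a w = v by rewrite /dshift submK // -vw2; case: (v).
pose q' := map_poly (tau a) q; pose k := (size p - size q)%N.
have q'v : q'.[x v] = tau a q.[x w] by rewrite -vE -tau_x horner_map.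
pose t := (lead_coef p)%:P * 'X^k * q'.
have tE : t.[x v] = lead_coef p * x v ^+ k * tau a q.[x w].
  by rewrite /t !hornerM hornerC hornerXn q'v.
(* p' is the pseudo-remainder, and t the multiple of tau a q subtracted. *)
pose h := tau a (lead_coef q); pose p' := h%:P * p - t.
have hp : h * p.[x v] = p'.[x v] + t.[x v].
  by rewrite /p' hornerD hornerN hornerM hornerC subrK.
have Bh : dpoly (below v) h by rewrite -vE; apply: dpoly_tau; exact: Bq.
have Bq' i : dpoly (below v) q'`_i.
  by rewrite coef_map -vE; apply: dpoly_tau.
suff : Q (h * p.[x v]).
  case/(dprimeP pQ) => //; first exact: dpolyS Bh.
    exact: horner_dpoly.
  by move/(dprime_tau pQ).
rewrite hp; apply: dprimeD => //; last first.
  by rewrite tE; apply: dprimeM => //; apply/dprime_tau.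
have tj j : t`_j = lead_coef p * (if (j < k)%N then 0 else q'`_(j - k)).
  by rewrite /t -mulrA coefCM coefXnM.
apply: IHd.
- rewrite -ltnS; apply: leq_trans szp; rewrite ltnS -(prednK szp0) ltnS.
  apply/leq_sizeP => j; rewrite leq_eqVlt coefB coefCM tj => /orP[/eqP <-|ltj].
    rewrite ifF; last by rewrite /k; lia.
    rewrite coef_map.
    have -> : ((size p).-1 - (size p - size q) = (size q).-1)%N by lia.
    by rewrite mulrC subrr.
  have pj : (size p <= j)%N by rewrite -(prednK szp0).
  rewrite (nth_default _ pj) mulr0 ifF; last by rewrite /k; lia.
  have -> : q'`_(j - k) = 0.
    apply: nth_default; apply: leq_trans (size_poly _ _) _.
    rewrite /k; move: (size q) (size p) pj szq; lia.
  by rewrite mulr0 subrr.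
- move=> i; rewrite coefB coefCM tj; apply: dpoly_add; first exact: dpoly_mul.
  apply/dpoly_opp/dpoly_mul; first exact: Bp.
  by case: ifP => _; [exact: dpoly_const|exact: Bq'].
- rewrite /p' hornerD hornerN hornerM hornerC tE.
  by apply: PD; [exact: PM|apply/PN/PM/Ptau].
Qed.

(** The ultrafilter U contains, for each finite part of S, the set of all bad t
    with that part in Q t, so that the ultralimit P of the Q t contains S. What
    makes P useful is that membership and non-membership of finitely many
    elements in P are shared by some bad Q t. *)
Theorem difference_basis (T : Type) (Q : T -> set A) (S : set A) :
  (forall t, difference_prime (Q t)) -> (forall f, S f -> dpoly setT f) ->
  exists l : seq A, (forall f, f \in l -> S f) /\
    forall t, (forall f, f \in l -> Q t f) -> S `<=` Q t.
Proof.
move=> pQ SR; apply: contrapT => noP.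
pose D := [set l : seq A | forall f, f \in l -> S f].
pose bad := [set t | ~ (S `<=` Q t)].
pose E (l : seq A) := [set t | bad t /\ forall f, f \in l -> Q t f].
have E0 l : D l -> E l !=set0.
  move=> Dl; apply: contrapT => nE; apply: noP; exists l; split=> // t Ql.
  by apply: contrapT => bt; apply: nE; exists t.
have FF : Filter (filter_from D E).
  apply: filter_from_filter; first by exists [::].
  move=> l1 l2 D1 D2; exists (l1 ++ l2) => [f|t [bt tl]].
    by rewrite mem_cat => /orP[/D1|/D2].
  by split; split=> // f fl; apply: tl; rewrite mem_cat fl ?orbT.
have PF := filter_from_proper FF E0.
have [U [UU FU]] := ultraFilterLemma PF.
have PU := @ultra_proper _ _ UU.
pose P := [set f : A | U [set t | Q t f]].
have Ubad : U bad by apply: FU; exists [::] => // t [].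
have SP : S `<=` P.
  move=> f Sf; apply: FU; exists [:: f]; first by move=> g; rewrite inE => /eqP ->.
  by move=> t [_]; apply; rewrite inE.
have PnP f : ~ P f -> U [set t | ~ Q t f].
  by have [//|] := in_ultra_setVsetC [set t | Q t f] UU.
pose good v (p : {poly A}) t := [/\ forall i, dpoly (below v) p`_i,
     P p.[x v], Q t p.[x v] & ~ Q t (lead_coef p)].
(* The leaders and sizes of the members of P with initial outside P. *)
pose W := [set k : V * nat | exists p : {poly A}, [/\ size p = k.2,
  forall i, dpoly (below k.1) p`_i, P p.[x k.1] & ~ P (lead_coef p)]].
pose fs := (fun k : V * nat => k.2) ::
  [seq (fun k : V * nat => k.1.1 i) | i <- enum 'I_n].
have [l [lW lP]] := dickson (fun k : V * nat => k.1.2) fs W.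
have Ul : U [set t | forall k, k \in l ->
    exists2 p : {poly A}, size p = k.2 & good k.1 p t].
  elim: l lW {lP} => [|k l IH] lW; first by apply: filterS filterT.
  have [p [szp Bp Pp /PnP nPl]] := lW k (mem_head _ _).
  have Ul : U [set t | forall k, k \in l ->
      exists2 p : {poly A}, size p = k.2 & good k.1 p t].
    by apply: IH => i il; apply: lW; rewrite inE il orbT.
  apply: filterS (filterI (filterI Pp nPl) Ul) => t [[Qp nQl] tl] i.
  by rewrite inE => /orP[/eqP ->|/tl //]; exists p.
have [t [bt tl]] := filter_ex (filterI Ubad Ul).
apply: bt => f Sf.
pose lead := [set vp : V * {poly A} | (vp.1, size vp.2) \in l /\ good vp.1 vp.2 t].
apply: (@pseudo_reduction P (Q t) lead) (SR f Sf) (SP f Sf).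
- exact: pQ.
- move=> g h Pg Ph; apply: filterS (filterI Pg Ph) => s [].
  exact: dprimeD.
- by move=> g h Ph; apply: filterS Ph => s; exact: dprimeM.
- by move=> a g Pg; apply: filterS Pg => s Qg; apply/dprime_tau.
- by move=> g cg /filter_ex[s]; exact: dprime_const.
- by move=> v q [_ []].
- move=> v p Bp Pp nPl.
  have [|[[a i] e] wl [/= vw]] := lP (v, size p); first by exists p.
  move=> /andP[szp /allP wv]; have [q szq gq] := tl _ wl.
  exists (a, i), q; split=> //; first by rewrite /lead /= szq.
    apply/mnm_lepP => j; apply: (wv (fun k : V * nat => k.1.1 j)).
    by apply: (map_f (fun j (k : V * nat) => k.1.1 j)); rewrite mem_enum.
  by rewrite szq.
Qed.

End DifferenceBasis.

(** * The group generated by the transvections of the plane *)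

Section Transvections.
Variable K : comUnitRingType.

(** The transvection fixing the vector (1, c): with v = (1, c) as a column
    and w = (-c, 1) as a row, w v = 0 and so (1 + s v w)(1 + t v w) =
    1 + (s + t) v w. *)
Definition transv (c s : K) : 'M[K]_2 :=
  1 + s *: ((\col_(i < 2) (if i == 0 then 1 else c)) *m
            (\row_(j < 2) (if j == 0 then - c else 1))).

Lemma transvE c s (i j : 'I_2) : transv c s i j =
  (i == j)%:R + s * ((if i == 0 then 1 else c) * (if j == 0 then - c else 1)).
Proof. by rewrite !mxE big_ord1 !mxE. Qed.

Lemma mx2P (M N : 'M[K]_2) :
  M 0 0 = N 0 0 -> M 0 1 = N 0 1 -> M 1 0 = N 1 0 -> M 1 1 = N 1 1 -> M = N.
Proof.
move=> e00 e01 e10 e11; apply/matrixP => i j.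
have I2 (k : 'I_2) : k = 0 \/ k = 1.
  by case: k => -[|[|//]] k2; [left|right]; exact: val_inj.
by case: (I2 i) (I2 j) => -> [] ->.
Qed.

Lemma mulmx2 (M N : 'M[K]_2) i j : (M * N) i j = M i 0 * N 0 j + M i 1 * N 1 j.
Proof.
rewrite mxE !big_ord_recl big_ord0 addr0.
by congr (_ + _ * _); congr (_ _ _); exact: val_inj.
Qed.

Lemma transvD c s t : transv c (s + t) = transv c s * transv c t.
Proof. by apply: mx2P; rewrite !mulmx2 !transvE /=; ring. Qed.

Lemma transv0 c : transv c 0 = 1.
Proof. by rewrite /transv scale0r addr0. Qed.

Definition transv_prod (l : seq (K * K)) : 'M[K]_2 :=
  \prod_(p <- l) transv p.1 p.2.

Lemma transv_prodV l :
  transv_prod l * transv_prod (rev [seq (p.1, - p.2) | p <- l]) = 1.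
Proof.
elim: l => [|[c s] l IH]; first by rewrite /transv_prod !big_nil mulr1.
rewrite /transv_prod /= rev_cons -cats1 big_cons big_cat big_seq1 /=.
rewrite mulrA -(mulrA (transv c s)) [X in _ * X * _]IH mulr1.
by rewrite -transvD subrr transv0.
Qed.

(** Being a product of transvections, an element can be deformed to the
    identity along a polynomial curve, by scaling the parameters. This makes
    the set of representations in E2 irreducible. *)
Record E2 := MkE2 {
  E2_mx :> 'M[K]_2;
  E2P : `[< exists l, E2_mx = transv_prod l >] }.
HB.instance Definition _ := [isSub for E2_mx].
HB.instance Definition _ := [Choice of E2 by <:].

Implicit Types g h : E2.

Lemma E2_one : `[< exists l, 1 = transv_prod l >].
Proof. by apply/asboolP; exists [::]; rewrite /transv_prod big_nil. Qed.

Lemma E2_mul g h : `[< exists l, E2_mx g * h = transv_prod l >].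
Proof.
have /asboolP[l1 ->] := E2P g; have /asboolP[l2 ->] := E2P h.
by apply/asboolP; exists (l1 ++ l2); rewrite /transv_prod big_cat.
Qed.

Lemma E2_inv g : `[< exists l, (E2_mx g)^-1 = transv_prod l >].
Proof.
have /asboolP[l ->] := E2P g; apply/asboolP.
exists (rev [seq (p.1, - p.2) | p <- l]).
have lV := transv_prodV l; have [lu _] := mulmx1_unit lV.
by rewrite -[LHS]mulr1 -lV mulKr.
Qed.

Lemma E2_unit g : E2_mx g \is a GRing.unit.
Proof.
by have /asboolP[l ->] := E2P g; case: (mulmx1_unit (transv_prodV l)).
Qed.

Definition mul2 g h := MkE2 (E2_mul g h).
Definition inv2 g := MkE2 (E2_inv g).
Definition one2 := MkE2 E2_one.

Lemma mul2A : associative mul2.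
Proof. by move=> g h k; apply: val_inj; rewrite /= mulrA. Qed.
Lemma mul12 : left_id one2 mul2.
Proof. by move=> g; apply: val_inj; rewrite /= mul1r. Qed.
Lemma mul21 : right_id one2 mul2.
Proof. by move=> g; apply: val_inj; rewrite /= mulr1. Qed.
Lemma mulV2 : left_inverse one2 inv2 mul2.
Proof. by move=> g; apply: val_inj; rewrite /= mulVr ?E2_unit. Qed.
Lemma mul2V : right_inverse one2 inv2 mul2.
Proof. by move=> g; apply: val_inj; rewrite /= mulrV ?E2_unit. Qed.

HB.instance Definition _ := isGroup.Build E2 mul2A mul12 mul21 mulV2 mul2V.

Lemma transv_prod_E2 l : `[< exists l', transv_prod l = transv_prod l' >].
Proof. by apply/asboolP; exists l. Qed.

End Transvections.

Section Evaluation.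
Variables (K L : comUnitRingType) (f : {rmorphism K -> L}).

Lemma map_transv c s : map_mx f (transv c s) = transv (f c) (f s).
Proof.
apply/matrixP => i j; rewrite mxE !transvE rmorphD rmorph_nat !rmorphM.
by case: ifP; case: ifP; rewrite ?rmorphN ?rmorph1.
Qed.

Lemma map_transv_prod l :
  map_mx f (transv_prod l) = transv_prod [seq (f p.1, f p.2) | p <- l].
Proof.
elim: l => [|p l IH]; first by rewrite /transv_prod !big_nil map_mx1.
by rewrite /transv_prod /= !big_cons map_mxM map_transv; congr (_ *m _).
Qed.

Lemma E2_map_proof (g : E2 K) : `[< exists l, map_mx f g = transv_prod l >].
Proof.
have /asboolP[l ->] := E2P g; rewrite map_transv_prod.
by apply/asboolP; eexists.
Qed.

Definition E2_map (g : E2 K) : E2 L := MkE2 (E2_map_proof g).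

Lemma E2_mapM : {morph E2_map : g h / (g * h)%g}.
Proof. by move=> g h; apply: val_inj; rewrite /= map_mxM. Qed.

HB.instance Definition _ := isMultiplicative.Build (E2 K) (E2 L) E2_map E2_mapM.

End Evaluation.

(** * Homomorphisms out of a free group *)

Lemma multiplicative1 (G H : groupType) (h : {multiplicative G -> H}) :
  h 1%g = 1%g.
Proof. by apply: (mulgI (h 1%g)); rewrite -gmulfM !mulg1. Qed.

Section FreeRep.
Variables (F : groupType) (I : choiceType) (x : I -> F).
Hypothesis xF : free_basis x.

Lemma free_extend (H : groupType) (g : I -> H) :
  exists h : {multiplicative F -> H}, forall i, h (x i) = g i.
Proof.
case: xF => b bK Kb.
pose bM := isMultiplicative.Build _ _ b (can2_gmulfM bK Kb).
pose b' : {multiplicative F -> freeGroup I} := HB.pack b bM.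
exists (fg_lift g \o b') => i /=.
by rewrite /b' /= -(fg_lift_gen x i) bK fg_lift_gen.
Qed.

Lemma free_lift_comp (H : groupType) (h : {multiplicative F -> H}) w :
  h (fg_lift x w) = fg_lift (h \o x) w.
Proof.
pose hx : {multiplicative freeGroup I -> H} := h \o fg_lift x.
rewrite -[LHS]/(hx w) fg_lift_uniq.
by congr (fg_lift _ w); apply/funext => i /=; rewrite fg_lift_gen.
Qed.

Lemma free_ext (H : groupType) (h h' : {multiplicative F -> H}) :
  (forall i, h (x i) = h' (x i)) -> forall y, h y = h' y.
Proof.
move=> hh' y; case: xF => b _ Kb; rewrite -(Kb y) !free_lift_comp.
by congr (fg_lift _ _); apply/funext => i /=.
Qed.

(** Write the images of a basis element under r0 and r1 as products of
    transvections, scale all parameters of the first by 1 - 'X and of the second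
    by 'X, and multiply. Since the basis is free, this defines a representation
    over the polynomials; one of the two factors is trivial at 0, the other
    at 1. *)
Lemma rep_curve (r0 r1 : {multiplicative F -> E2 rat}) :
  exists R : {multiplicative F -> E2 {poly rat}},
    (forall y, E2_map (horner_eval (0 : rat)) (R y) = r0 y) /\
    (forall y, E2_map (horner_eval (1 : rat)) (R y) = r1 y).
Proof.
have lP (r : {multiplicative F -> E2 rat}) i :
    exists l, E2_mx (r (x i)) = transv_prod l.
  by have /asboolP := E2P (r (x i)).
pose l0 i := sval (cid (lP r0 i)); pose l1 i := sval (cid (lP r1 i)).
have l0P i : E2_mx (r0 (x i)) = transv_prod (l0 i) := svalP (cid (lP r0 i)).
have l1P i : E2_mx (r1 (x i)) = transv_prod (l1 i) := svalP (cid (lP r1 i)).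
pose sc (s : {poly rat}) (p : rat * rat) := (p.1%:P, p.2%:P * s).
have [R RP] := free_extend (fun i => MkE2 (transv_prod_E2
  (map (sc (1 - 'X)) (l0 i) ++ map (sc 'X) (l1 i)))).
have ev t s u (l : seq (rat * rat)) : s.[t] = u ->
    map_mx (horner_eval t) (transv_prod (map (sc s) l)) =
    transv_prod [seq (p.1, p.2 * u) | p <- l].
  move=> <-; rewrite map_transv_prod -map_comp; congr transv_prod.
  by apply: eq_map => p /=; rewrite /horner_eval hornerM !hornerC.
have m1 (l : seq (rat * rat)) : [seq (p.1, p.2 * 1) | p <- l] = l.
  by rewrite -[RHS]map_id; apply: eq_map => -[c s] /=; rewrite mulr1.
have m0 (l : seq (rat * rat)) : transv_prod [seq (p.1, p.2 * 0) | p <- l] = 1.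
  elim: l => [|p l IH]; rewrite /transv_prod /= ?big_nil // big_cons.
  by rewrite mulr0 transv0 mul1r.
have catE (l l' : seq ({poly rat} * {poly rat})) :
    transv_prod (l ++ l') = transv_prod l * transv_prod l'.
  by rewrite /transv_prod big_cat.
exists R; split; [apply: (@free_ext _ (E2_map (horner_eval 0) \o R) r0)
                 |apply: (@free_ext _ (E2_map (horner_eval 1) \o R) r1)];
  move=> i; apply: val_inj; rewrite /= RP /= catE map_mxM.
- rewrite (ev _ _ 1) ?(ev _ _ 0) ?hornerE ?subr0 //.
  by rewrite m0 m1 mulmx1 l0P.
- rewrite (ev _ _ 0) ?(ev _ _ 1) ?hornerE ?subrr //.
  by rewrite m0 m1 mul1mx l1P.
Qed.

End FreeRep.

(** * Free groups are separated by transvections *)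

Lemma poly_nonroot (p : {poly rat}) : p != 0 -> exists t, p.[t] != 0.
Proof.
move=> p0; apply: contrapT => noP.
pose rs : seq rat := [seq i%:R | i <- iota 0 (size p)].
have : (size rs < size p)%N.
  apply: max_poly_roots => //.
    apply/allP => t _; apply/rootP; apply: contrapT => /eqP pt.
    by apply: noP; exists t.
  by rewrite map_inj_uniq ?iota_uniq //; exact: mulrIn (oner_neq0 _).
by rewrite size_map size_iota ltnn.
Qed.

(** The generator i acts by the transvection with vector (1, c i) and parameter
    'X. On a reduced word each syllable raises the degree by one, because the
    linear form of a syllable does not vanish on the vector of the previous one
    when their slopes c differ. *)
Section PingPong.
Variables (I : choiceType) (c : I -> rat).
Local Notation letter := (I * bool)%type.
Local Notation vect := ({poly rat} * {poly rat})%type.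

(** The row (- c i, 1) applied to y; it vanishes on the vector (1, c i), so
    that push_vect i adds up its parameters. *)
Definition lform (i : I) (y : vect) : {poly rat} := y.2 - c i *: y.1.

Definition push_vect (i : I) (k : rat) (y : vect) : vect :=
  (y.1 + k *: ('X * lform i y), y.2 + (c i * k) *: ('X * lform i y)).

Definition act (a : letter) : vect -> vect :=
  push_vect a.1 (if a.2 then 1 else -1).

Lemma act_same i (b : bool) k y :
  act (i, b) (push_vect i k y) = push_vect i (k + (if b then 1 else -1)) y.
Proof.
have li : lform i (push_vect i k y) = lform i y.
  by rewrite /lform /push_vect /= scalerDr scalerA opprD addrACA subrr addr0.
rewrite /act [LHS]/push_vect li /push_vect /= -!addrA -!scalerDl.
by congr (_, _ + _ *: _); rewrite -mulrDr.
Qed.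

Lemma lform_push j i k y : lform j (push_vect i k y) =
  lform j y + ((c i - c j) * k) *: ('X * lform i y).
Proof.
rewrite /lform /push_vect /= scalerDr scalerA opprD addrACA -scalerBl.
by rewrite mulrBl.
Qed.

Definition spread (D : nat) (y : vect) : Prop :=
  (size y.1 <= D.+1)%N /\ (size y.2 <= D.+1)%N.

Lemma size_Xlform i y D k : size (lform i y) = D.+1 -> k != 0 ->
  size (k *: ('X * lform i y)) = D.+2.
Proof.
move=> sl k0; rewrite size_scale // -['X * _]mulrC size_mulX ?sl //.
by rewrite -size_poly_gt0 sl.
Qed.

Lemma spread_push i k y D : spread D y -> size (lform i y) = D.+1 ->
  spread D.+1 (push_vect i k y).
Proof.
move=> [s1 s2] sl; have sX k' : (size (k' *: ('X * lform i y)) <= D.+2)%N.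
  have [->|k0] := eqVneq k' 0; first by rewrite scale0r size_poly0.
  by rewrite (size_Xlform sl).
split; rewrite /push_vect /=; apply: leq_trans (size_polyD _ _) _;
  by rewrite geq_max sX andbT (leq_trans _ (leqnSn _)).
Qed.

Lemma lform_spread i y D : spread D y -> (size (lform i y) <= D.+1)%N.
Proof.
move=> [s1 s2]; apply: leq_trans (size_polyD _ _) _.
by rewrite geq_max s2 size_polyN (leq_trans (size_scale_leq _ _)).
Qed.

(** The first syllable of the word acts by push_vect with parameter k, and y is
    the image of (0, 1) under the remaining syllables. The sign of k, which is
    that of the letters of the syllable, keeps it nonzero when a further equal
    letter is added. *)
Lemma ping_pong (a : letter) (w : seq letter) :
  reduced (a :: w) -> {in [seq b.1 | b <- a :: w] &, injective c} ->
  exists y k D, [/\ foldr act (0, 1) (a :: w) = push_vect a.1 k y,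
    (if a.2 then 0 < k else k < 0), spread D y & size (lform a.1 y) = D.+1].
Proof.
elim: w a => [|b w IH] [i e] red cinj.
  exists (0, 1), (if e then 1 else -1), 0%N; split=> //.
  - by case: (e); rewrite ?ltr01 ?ltrN10.
  - by split; rewrite ?size_poly0 ?size_poly1.
  - by rewrite /lform /= scaler0 subr0 size_poly1.
have [||y [k [D [yE ke sy ly]]]] := IH b.
- exact: path_sorted red.
- by move=> j l jw lw; apply: cinj; rewrite map_cons inE ?jw ?lw orbT.
rewrite [foldr _ _ _]/= -/(foldr act (0, 1) (b :: w)) yE.
have k0 : k != 0 by move: ke; case: ifP => _ kP; [rewrite gt_eqF|rewrite lt_eqF].
have [bi|nbi] := eqVneq b.1 i.
  have be : b.2 = e.
    case/andP: red => nab _; move: nab; case: (b) bi => j e' /= ->.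
    by rewrite /invl /= xpair_eqE eqxx; case: (e) (e') => [] [].
  exists y, (k + (if e then 1 else -1)), D; rewrite bi in ly *; rewrite act_same.
  by split=> //=; move: ke; rewrite be; case: (e) => /=; lra.
exists (push_vect b.1 k y), (if e then 1 else -1), D.+1; split=> //.
- by case: (e); rewrite ?ltr01 ?ltrN10.
- exact: spread_push.
have nz : (c b.1 - c i) * k != 0.
  rewrite mulf_neq0 // subr_eq0; apply: contra_neq nbi; apply: cinj.
    by rewrite !inE eqxx orbT.
  by rewrite !inE eqxx.
rewrite /= lform_push addrC size_polyDl (size_Xlform ly nz) //.
exact: lform_spread.
Qed.

Lemma act_word_neq (w : seq letter) : w != [::] ->
  reduced w -> {in [seq b.1 | b <- w] &, injective c} ->
  (foldr act (0, 1) w).1 != 0.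
Proof.
case: w => // a w _ red cinj.
have [y [k [D [-> ke [s1 _] ly]]]] := ping_pong red cinj.
have k0 : k != 0 by move: ke; case: ifP => _ kP; [rewrite gt_eqF|rewrite lt_eqF].
by rewrite -size_poly_gt0 /push_vect /= addrC size_polyDl (size_Xlform ly k0).
Qed.

End PingPong.

Section Separation.
Variables (F : groupType) (I : choiceType) (x : I -> F).
Hypothesis xF : free_basis x.

(** A word involves finitely many basis elements, so that their positions in
    the word serve as distinct slopes in Q. The upper right
    entry of the matrix of the word is a nonzero polynomial, and the parameter
    'X is specialised to a value at which it does not vanish. *)
Lemma rep_separates y : y != 1%g ->
  exists r : {multiplicative F -> E2 rat}, r y != 1%g.
Proof.
case: (xF) => b _ Kb; rewrite -(Kb y); set w := b y => w1.
have wn : val w != [::].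
  by apply: contra_neq w1 => w0; rewrite /fg_lift w0 big_nil.
pose c i : rat := (index i [seq a.1 | a <- val w])%:R.
have cinj : {in [seq a.1 | a <- val w] &, injective c}.
  by move=> i j iw jw /mulrIn -/(_ (oner_neq0 _))/index_inj; apply.
pose g i : E2 {poly rat} := MkE2 (transv_prod_E2 [:: ((c i)%:P, 'X)]).
have gE i : E2_mx (g i) = transv (c i)%:P 'X by rewrite /= /transv_prod big_seq1.
have [R RP] := free_extend xF g.
(* The second column of the matrix is the image of the vector (0, 1). *)
have Rw : (E2_mx (R (fg_lift x w)) 0 1, E2_mx (R (fg_lift x w)) 1 1)
    = foldr (act c) (0, 1) (val w).
  rewrite free_lift_comp /fg_lift; have -> : R \o x = g by apply/funext.
  elim: (val w) => [|[i e] s IH].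
    by rewrite big_nil /= !mxE.
  have lE : E2_mx (eval_letter g (i, e)) = transv (c i)%:P (if e then 'X else - 'X).
    case: e; rewrite /eval_letter /=; first exact: gE.
    rewrite -[LHS]mulr1 -(transv0 (c i)%:P) -(subrr 'X) transvD -gE.
    by rewrite mulKr //; exact: (E2_unit (g i)).
  rewrite big_cons /= -IH /= !mulmx2 lE !transvE /act /push_vect /lform /=.
  congr (_, _); rewrite -!mul_polyC.
    by case: e {lE}; rewrite /= ?polyCN; ring.
  by case: e {lE}; rewrite /= ?polyCM ?polyCN; ring.
have := act_word_neq wn (fg_reduced w) cinj; rewrite -Rw /=.
move=> /poly_nonroot[t tR]; exists (E2_map (horner_eval t) \o R).
apply: contra_neq tR => /(congr1 (fun M : E2 rat => E2_mx M 0 1)) /=.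
by rewrite !mxE.
Qed.

End Separation.

(** * Words in a semidirect product as difference polynomials *)

Section WordPolynomials.
Variable m : nat.

(** The unknowns: inl ((i, e), (r, c)) is an entry of the matrix of x_i, or of
    its inverse when e is false, and inr i is the exponent k_i. Giving the
    inverse its own unknowns keeps the word equations polynomial. *)
Definition entry : finType := (('I_m * bool) * ('I_2 * 'I_2) + 'I_m)%type.
Local Notation V := ('X_{1..m} * entry)%type.
Local Notation A := ((V -> rat) -> rat).

Definition translate (a : 'X_{1..m}) (f : A) : A := fun z => f (z \o dshift a).

Lemma translateB a : zmod_morphism (translate a).
Proof. by []. Qed.
Lemma translateM a : monoid_morphism (translate a).
Proof. by []. Qed.
HB.instance Definition _ a :=
  GRing.isZmodMorphism.Build A A (translate a) (translateB a).
HB.instance Definition _ a :=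
  GRing.isMonoidMorphism.Build A A (translate a) (translateM a).

Definition tau (a : 'X_{1..m}) : {rmorphism A -> A} := translate a.
Definition coord (v : V) : A := fun z => z v.
Definition consts : set A := [set f | exists c, f = cst c].

Lemma tau_consts a f : consts f -> consts (tau a f).
Proof. by case=> c ->; exists c. Qed.

Lemma const_dpoly f : dpoly coord consts set0 f -> consts f.
Proof.
elim=> {f} [//|//|_ _ _ [c ->] _ [d ->]|_ _ [c ->]|_ _ _ [c ->] _ [d ->]].
- by exists (c + d).
- by exists (- c).
- by exists (c * d).
Qed.

(** Polynomials are modelled by the functions they define; along a polynomial
    curve such a function is a polynomial in the parameter. *)
Lemma dpoly_curve (u : V -> {poly rat}) f : dpoly coord consts setT f ->
  exists p : {poly rat}, forall t, f (fun v => (u v).[t]) = p.[t].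
Proof.
elim=> {f} [_ [c ->]|v _|f g _ [p fp] _ [q gq]|f _ [p fp]|f g _ [p fp] _ [q gq]].
- by exists c%:P => t; rewrite hornerC.
- by exists (u v).
- by exists (p + q) => t; rewrite hornerD -fp -gq.
- by exists (- p) => t; rewrite hornerN -fp.
- by exists (p * q) => t; rewrite hornerM -fp -gq.
Qed.

Definition letter_mx (b : 'X_{1..m}) (a : 'I_m * bool) (z : V -> rat) : 'M[rat]_2 :=
  \matrix_(r, c) z (b, inl (a, (r, c))).

(** The vector b records the power of t in front of the remaining word, since
    t^(b.k) (x_i t^(k_i)) = phi^(b.k)(x_i) t^((b + U_(i)).k) and
    t^(b.k) (x_i t^(k_i))^-1 = phi^((b - U_(i)).k)(x_i^-1) t^((b - U_(i)).k).
    The subtraction is truncated, and b has to be large enough at the start. *)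
Fixpoint word_mx (b : 'X_{1..m}) (w : seq ('I_m * bool)) (z : V -> rat) :
    'M[rat]_2 :=
  if w is (i, e) :: w' then
    if e then letter_mx b (i, e) z * word_mx (b + U_(i))%MM w' z
    else letter_mx (b - U_(i))%MM (i, e) z * word_mx (b - U_(i))%MM w' z
  else 1.

Definition word_exp (w : seq ('I_m * bool)) (z : V -> rat) : rat :=
  \sum_(a <- w) (if a.2 then 1 else -1) * z (0%MM, inr a.1).

Lemma word_mx_dpoly b w r c :
  dpoly coord consts setT (fun z => word_mx b w z r c).
Proof.
have step b' a (M : (V -> rat) -> 'M[rat]_2) r' c' :
    (forall i j, dpoly coord consts setT (fun z => M z i j)) ->
    dpoly coord consts setT (fun z => (letter_mx b' a z * M z) r' c').
  move=> dM; pose f j : A := coord (b', inl (a, (r', j))).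
  have -> : (fun z => (letter_mx b' a z * M z) r' c') =
      (f 0 * (fun z => M z 0 c') + f 1 * (fun z => M z 1 c') : A).
    by apply/funext => z; rewrite mulmx2 !mxE.
  by apply: dpoly_add; apply: dpoly_mul => //; exact: dpoly_var.
elim: w b r c => [|[i []] w IH] b r c /=; try exact: step.
by apply: dpoly_const; exists ((1 : 'M[rat]_2) r c).
Qed.

Lemma word_exp_dpoly w : dpoly coord consts setT (word_exp w).
Proof.
elim: w => [|[i e] w IH].
  by apply: dpoly_const; exists 0; apply/funext => z; rewrite /word_exp big_nil.
have -> : word_exp ((i, e) :: w) =
    (cst (if e then 1 else -1) * coord (0%MM, inr i) + word_exp w : A).
  by apply/funext => z; rewrite /word_exp big_cons.
apply: dpoly_add => //; apply: dpoly_mul; last exact: dpoly_var.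
by apply: dpoly_const; eexists.
Qed.

(** A starting vector from which a word never leaves N^m. *)
Definition word_base (w : seq ('I_m * bool)) : 'X_{1..m} :=
  [multinom size w | i < m].

Definition word_eqs (s : freeGroup 'I_m) : set A :=
  [set f | f = word_exp s \/ exists r c,
     f = fun z => word_mx (word_base s) s z r c - (r == c)%:R].

Lemma word_eqs_dpoly s f : word_eqs s f -> dpoly coord consts setT f.
Proof.
move=> [->|[r [c ->]]]; first exact: word_exp_dpoly.
apply: (@dpoly_add _ _ _ _ _ _ (fun z => word_mx (word_base s) s z r c)
  (cst (- (r == c)%:R))); first exact: word_mx_dpoly.
by apply: dpoly_const; eexists.
Qed.

Section Points.
Variables (F : groupType) (phi : automorphism F).
Local Notation G := (semidirectZ phi).

HB.instance Definition _ k :=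
  isMultiplicative.Build F F (aut_expz phi k) (aut_expzM phi k).

Definition base_letter (g : 'I_m -> G) (a : 'I_m * bool) : F :=
  if a.2 then sd_base (g a.1) else (sd_base (g a.1))^-1%g.

Definition total_exp (g : 'I_m -> G) (b : 'X_{1..m}) : int :=
  \sum_i sd_exp (g i) *+ b i.

Lemma total_expD g a b : total_exp g (a + b)%MM = total_exp g a + total_exp g b.
Proof. by rewrite -big_split; apply: eq_bigr => i _; rewrite mnmDE mulrnDr. Qed.

Lemma total_expU g i : total_exp g U_(i)%MM = sd_exp (g i).
Proof.
rewrite /total_exp (bigD1 i) //= mnm1E eqxx mulr1n big1 ?addr0 // => j ji.
by rewrite mnm1E eq_sym (negbTE ji).
Qed.

Definition point (g : 'I_m -> G) (r : {multiplicative F -> E2 rat}) : V -> rat :=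
  fun v => match v.2 with
  | inl (a, (i, j)) =>
      E2_mx (r (aut_expz phi (total_exp g v.1) (base_letter g a))) i j
  | inr i => (sd_exp (g i))%:~R
  end.

Definition vanishing (g : 'I_m -> G) : set A :=
  [set f | forall r, f (point g r) = 0].

(** Translation of the coordinates is precomposition with a power of phi; this
    is why a family of all representations, rather than a single one, is
    needed. *)
Lemma point_shift g (r : {multiplicative F -> E2 rat}) a :
  point g r \o dshift a = point g (r \o aut_expz phi (total_exp g a)).
Proof.
apply/funext => -[b [[l [i j]]|i]] //=.
by rewrite /point /= total_expD aut_expzD.
Qed.

Lemma letter_mx_point g r b a : letter_mx b a (point g r) =
  r (aut_expz phi (total_exp g b) (base_letter g a)).
Proof. by apply/matrixP => i j; rewrite mxE. Qed.

Lemma word_mx_point g r (b : 'X_{1..m}) w : (forall i, (size w <= b i)%N) ->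
  word_mx b w (point g r) =
  r (aut_expz phi (total_exp g b) (sd_base (\prod_(a <- w) eval_letter g a)%g)).
Proof.
elim: w b => [|[i e] w IH] b wb.
  by rewrite big_nil /= aut_expz1 multiplicative1.
rewrite big_cons; set u := eval_letter g _; set v := (\prod_(a <- _) _)%g in IH *.
have -> : sd_base (u * v)%g = (sd_base u * aut_expz phi (sd_exp u) (sd_base v))%g.
  by [].
rewrite aut_expzM -aut_expzD gmulfM [RHS]/=.
case: e wb @u => wb u /=; rewrite letter_mx_point.
  rewrite IH; first by rewrite total_expD total_expU.
  by move=> j; rewrite mnmDE; apply: leq_trans (leq_addr _ _); exact: ltnW (wb j).
have bE : b = ((b - U_(i)) + U_(i))%MM.
  rewrite submK //; apply/mnm_lepP => j; rewrite mnm1E.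
  by apply: leq_trans (wb j); case: (i == j).
have tE : total_exp g b - sd_exp (g i) = total_exp g (b - U_(i))%MM.
  by rewrite {1}bE total_expD total_expU addrK.
rewrite IH; last first.
  move=> j; rewrite mnmBE mnm1E; have := wb j; rewrite /=.
  by case: (i == j); lia.
by rewrite -tE /u /eval_letter /= -aut_expzD.
Qed.

Lemma word_exp_point g r w :
  word_exp w (point g r) = (sd_exp (\prod_(a <- w) eval_letter g a)%g)%:~R.
Proof.
rewrite /word_exp; elim: w => [|[i e] w IH]; first by rewrite !big_nil.
rewrite !big_cons [sd_exp _]/= rmorphD /= IH; congr (_ + _).
by case: e; rewrite /eval_letter /= ?mul1r // mulN1r rmorphN.
Qed.

Variables (I : choiceType) (x : I -> F).
Hypothesis xF : free_basis x.

(** The matrix equations at all representations r say that r is trivial on the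
    image of the word's F-component under a power of phi; the representations
    separate points, and that power is injective. *)
Lemma word_eqsP g s : fg_lift g s = 1%g <-> word_eqs s `<=` vanishing g.
Proof.
have sb i : (size (fg_word s) <= word_base s i)%N by rewrite mnmE.
split=> [s1 f [->|[i [j ->]]] r|sQ].
- by rewrite word_exp_point -[X in sd_exp X]/(fg_lift g s) s1.
- rewrite word_mx_point // -[X in sd_base X]/(fg_lift g s) s1.
  by rewrite aut_expz1 multiplicative1 mxE subrr.
have [r0 _] := free_extend xF (fun _ => 1%g : E2 rat).
have e0 : sd_exp (fg_lift g s) = 0.
  have /= := sQ _ (or_introl erefl) r0.
  by rewrite word_exp_point => /eqP; rewrite intr_eq0 => /eqP.
suff b1 : sd_base (fg_lift g s) = 1%g.
  by case: (fg_lift g s) e0 b1 => b e /= -> ->.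
set k := total_exp g (word_base s).
suff : aut_expz phi k (sd_base (fg_lift g s)) = 1%g.
  move/(congr1 (aut_expz phi (- k))).
  by rewrite -aut_expzD addNr aut_expz1.
apply: contrapT => /eqP /(rep_separates xF)[r /eqP]; apply.
apply: val_inj; apply/matrixP => i j.
have /= := sQ _ (or_intror (ex_intro _ i (ex_intro _ j erefl))) r.
by rewrite word_mx_point // => /eqP; rewrite subr_eq0 => /eqP ->; rewrite mxE.
Qed.

(** Invariance is point_shift together with the invertibility of phi. For
    primality, if f is nonzero at the point of r0 and h at that of r1, both are
    nonzero polynomials along the curve from r0 to r1, so that f * h is nonzero
    at some point of it. *)
Lemma vanishing_prime g : difference_prime tau coord consts (vanishing g).
Proof.
split.
- by [].
- by move=> f h f0 h0 r; rewrite -[LHS]/(f _ + h _) f0 h0 addr0.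
- by move=> f h h0 r; rewrite -[LHS]/(f _ * h _) h0 mulr0.
- move=> a f; split=> f0 r; last first.
    by rewrite -[LHS]/(f (point g r \o dshift a)) point_shift; exact: f0.
  have := f0 (r \o aut_expz phi (- total_exp g a)).
  rewrite -[LHS]/(f (_ \o dshift a)) point_shift => <-; congr (f _).
  apply/funext => -[b [[l [i j]]|i]] //=; rewrite /point /=.
  by rewrite -aut_expzD addNr.
- move=> f /const_dpoly[c ->] c0.
  have [r0 _] := free_extend xF (fun _ => 1%g : E2 rat).
  by apply/funext => z; have := c0 r0.
move=> f h df dh fh; apply: contrapT => /not_orP[nf nh].
have [r0 f0] : exists r, f (point g r) != 0.
  apply: contrapT => nE; apply: nf => r; apply: contrapT => /eqP fr.
  by apply: nE; exists r.
have [r1 h1] : exists r, h (point g r) != 0.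
  apply: contrapT => nE; apply: nh => r; apply: contrapT => /eqP hr.
  by apply: nE; exists r.
have [R [R0 R1]] := rep_curve xF r0 r1.
(* The point of the representation R, with polynomial coordinates. *)
pose u : V -> {poly rat} := fun v => match v.2 with
  | inl (a, (i, j)) =>
      E2_mx (R (aut_expz phi (total_exp g v.1) (base_letter g a))) i j
  | inr i => (sd_exp (g i))%:~R
  end.
have uE t : (fun v => (u v).[t]) = point g (E2_map (horner_eval t) \o R).
  apply/funext => -[b [[l [i j]]|i]]; rewrite /u /point /=; first by rewrite mxE.
  by rewrite -[LHS]/(horner_eval t _) rmorph_int.
have pointE (r r' : {multiplicative F -> E2 rat}) : (forall y, r y = r' y) ->
    point g r = point g r'.
  by move=> rr'; apply/funext => -[b [[l [i j]]|i]]; rewrite /point //= rr'.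
have [p pE] := dpoly_curve u df; have [q qE] := dpoly_curve u dh.
have p0 : p != 0.
  apply: contra_neq f0 => p0; have := pE 0; rewrite p0 horner0 uE => <-.
  by congr (f _); apply: pointE => y; rewrite -R0.
have q0 : q != 0.
  apply: contra_neq h1 => q0; have := qE 1; rewrite q0 horner0 uE => <-.
  by congr (h _); apply: pointE => y; rewrite -R1.
have [t] := poly_nonroot (mulf_neq0 p0 q0).
by rewrite hornerM -pE -qE uE => /eqP; apply; exact: fh.
Qed.

Lemma noetherian_system (S : set (freeGroup 'I_m)) :
  exists S0 : set (freeGroup 'I_m),
    [/\ finite_set S0, S0 `<=` S & solution_set G S0 = solution_set G S].
Proof.
pose E : set A := [set f | exists2 s, S s & word_eqs s f].
have [l [lE lP]] : exists l : seq A, (forall f, f \in l -> E f) /\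
    forall g, (forall f, f \in l -> vanishing g f) -> E `<=` vanishing g.
  apply: (@difference_basis _ _ _ tau coord consts) => //.
  - exact: tau_consts.
  - by exists 0.
  - by exists 1.
  - exact: vanishing_prime.
  - by move=> f [s _ /word_eqs_dpoly].
have [L [LS LE]] : exists L : seq (freeGroup 'I_m), (forall s, s \in L -> S s) /\
    forall f, f \in l -> exists2 s, s \in L & word_eqs s f.
  elim: l lE {lP} => [|f l IH] lE; first by exists [::].
  have [|L [LS LE]] := IH; first by move=> h hl; apply: lE; rewrite inE hl orbT.
  have [s Ss sf] := lE f (mem_head _ _).
  exists (s :: L); split=> [s'|h].
    by rewrite inE => /orP[/eqP ->//|/LS].
  rewrite inE => /orP[/eqP ->|/LE[s' s'L s'h]].
    by exists s; rewrite ?mem_head.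
  by exists s'; rewrite // inE s'L orbT.
exists [set` L]; split.
- exact: finite_seq.
- by move=> s /= /LS.
- apply/seteqP; split=> g gS s; last by move=> /LS; exact: gS.
  move=> Ss; apply/word_eqsP => f sf; apply: lP; last by exists s.
  by move=> h /LE[s' s'L]; apply: (word_eqsP g s').1; exact: gS.
Qed.

End Points.
End WordPolynomials.

Lemma equationally_Noetherian_semidirect (F : groupType) (phi : automorphism F) :
  is_free F -> equationally_Noetherian (semidirectZ phi).
Proof. by move=> [I [x xF]] m _ S; exact: noetherian_system xF S. Qed.

Lemma equationally_Noetherian_iso (G H : groupType)
    (h : {multiplicative H -> G}) : bijective h ->
  equationally_Noetherian H -> equationally_Noetherian G.
Proof.
move=> [h' hK Kh] EN m m0 S; have [S0 [fS0 S0S VS]] := EN m m0 S.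
have h1 x : (h x = 1%g) <-> x = 1%g.
  by rewrite -(multiplicative1 h); split=> [/(can_inj hK)|->].
have solE (S' : set (freeGroup 'I_m)) g : solution_set G S' g <-> solution_set H S' (h' \o g).
  have liftE s : fg_lift g s = h (fg_lift (h' \o g) s).
    pose hl : {multiplicative freeGroup 'I_m -> G} := h \o fg_lift (h' \o g).
    rewrite -[RHS]/(hl s) fg_lift_uniq; congr (fg_lift _ s).
    by apply/funext => i; rewrite /hl /= fg_lift_gen /= Kh.
  by split=> gS s /gS; rewrite liftE h1.
exists S0; split=> //; apply/seteqP.
by split=> g; rewrite !solE VS.
Qed.

Theorem theorem1p1 :
  (forall (F : groupType) (phi : automorphism F),
     is_free F -> finitely_generated F ->
     equationally_Noetherian (semidirectZ phi)) /\
  (forall G : groupType, free_by_cyclic G -> equationally_Noetherian G).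
Proof.
split=> [F phi freeF _|G [F [phi [freeF _ [h hbij]]]]].
  exact: equationally_Noetherian_semidirect.
apply: equationally_Noetherian_iso hbij _.
exact: equationally_Noetherian_semidirect.
Qed.
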